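(* Assume $\phi_c(\cdot)$ and $\phi_g(\cdot)$ are convex functions and $t_a(\cdot)$ is monotone increasing for every $a\in\mathcal{A}$. Then $(\boldsymbol c^*,\boldsymbol g^*,\boldsymbol{\hat x}^*,\boldsymbol{\check x}^*,\boldsymbol x^*,\boldsymbol q^*;\boldsymbol\lambda)$ is a primal-dual solution of the combined model defined in the context, where $\boldsymbol\lambda=(\lambda^k_{\boldsymbol\xi})$ are the dual variables of its market clearing constraints, if and only if $(\boldsymbol c^*,\boldsymbol g^*,\boldsymbol{\hat x}^*,\boldsymbol{\check x}^*,\boldsymbol x^*,\boldsymbol q^* )$ is a system equilibrium (as defined in the context) with equilibrium price vector $\rho^k_{\boldsymbol\xi}=\lambda^k_{\boldsymbol\xi}/\pi_{\boldsymbol\xi}$ for every $\boldsymbol\xi\in\boldsymbol\Xi$ and $k\in K$, where $\{\pi_{\boldsymbol\xi}:\boldsymbol\xi\in\boldsymbol\Xi\}$ is the probability distribution of $\boldsymbol\xi$.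
   Context: Network. $\mathcal{G}=(\mathcal{N},\mathcal{A})$ is a finite directed graph with nodes $\mathcal{N}$ and links $\mathcal{A}$. $R,S\subset\mathcal{N}$ are the sets of origins and destinations, $K\subset\mathcal{N}$ is the set of candidate service facility locations, and $K^{rs}\subset K$ is the set of facility locations available to travelers from $r$ to $s$. $A$ is the node-link incidence matrix (for each link, entry $1$ at its starting node and $-1$ at its ending node, $0$ elsewhere). $E^{ij}\in\mathbb{R}^{\mathcal{N}}$ is the O-D incidence vector with $1$ at origin $i$ and $-1$ at destination $j$ (zero elsewhere). $P^{rsk}$ is the finite set of paths from $r$ to $s$ with service at $k$; each $p\in P^{rsk}$ consists of a sub-path $\hat p$ from $r$ to $k$ followed by a sub-path $\check p$ from $k$ to $s$. $B_{\hat p},B_{\check p}\in\{0,1\}^{\mathcal{A}}$ are their link-path incidence vectors. $t_a(\cdot)$ is the travel time function of link $a$ as a function of its flow. Data. $\boldsymbol{\Xi}$ is a finite set of scenarios $\boldsymbol{\xi}$ with probabilities $\pi_{\boldsymbol{\xi}}>0$, and $\mathbb{E}_{\boldsymbol{\xi}}$ is the corresponding expectation. $d^{rs}_{\boldsymbol{\xi}}$ is the travel demand from $r$ to $s$ in scenario $\boldsymbol{\xi}$. $e^{rs}$ is the average service demand per user from $r$ to $s$. $\beta_0^k\in\mathbb{R}$, $\beta_1>0$, $\beta_2>0$ are utility parameters. $\phi_c,\phi_g:[0,\infty)\to\mathbb{R}$ are the aggregate capital and operational cost functions. Convention: $0\ln0=0$. Investor problem (given prices $\boldsymbol\rho=(\rho^k_{\boldsymbol\xi})$):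 maximize $\mathbb{E}_{\boldsymbol\xi}\sum_{k\in K}[\rho^k_{\boldsymbol\xi}g^k_{\boldsymbol\xi}-\phi_g(g^k_{\boldsymbol\xi})]-\sum_{k\in K}\phi_c(c^k)$ over capacities $c^k\ge0$ and supplies $g^k_{\boldsymbol\xi}\ge0$, subject to (C1) $g^k_{\boldsymbol\xi}-c^k\le0$ for all $k\in K$, $\boldsymbol\xi\in\boldsymbol\Xi$. GCDA problem in scenario $\boldsymbol\xi$ (given prices $\boldsymbol\rho_{\boldsymbol\xi}$): minimize $$\sum_{a\in\mathcal{A}}\int_0^{v_{a,\boldsymbol\xi}}t_a(u)\,du+\frac1{\beta_1}\sum_{r\in R}\sum_{s\in S}\sum_{k\in K^{rs}}q^{rsk}_{\boldsymbol\xi}\left(\ln q^{rsk}_{\boldsymbol\xi}-1+\beta_2\rho^k_{\boldsymbol\xi}e^{rs}-\beta_0^k\right)$$ over nonnegative link flows $\boldsymbol{\hat x}^{rsk}_{\boldsymbol\xi},\boldsymbol{\check x}^{rsk}_{\boldsymbol\xi}\in\mathbb{R}^{\mathcal{A}}$, path flows $x_{p,\boldsymbol\xi}$ and trip flows $q^{rsk}_{\boldsymbol\xi}$, subject to (C2): $v_{a,\boldsymbol\xi}=\sum_{r\in R}\sum_{s\in S}\sum_{k\in K^{rs}}(\hat x^{rsk}_{a,\boldsymbol\xi}+\check x^{rsk}_{a,\boldsymbol\xi})$ for all $a\in\mathcal{A}$; $\boldsymbol{\hat x}^{rsk}_{\boldsymbol\xi}+\boldsymbol{\check x}^{rsk}_{\boldsymbol\xi}=\sum_{p\in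 P^{rsk}}(B_{\hat p}+B_{\check p})x_{p,\boldsymbol\xi}$, $A\boldsymbol{\hat x}^{rsk}_{\boldsymbol\xi}=q^{rsk}_{\boldsymbol\xi}E^{rk}$ and $A\boldsymbol{\check x}^{rsk}_{\boldsymbol\xi}=q^{rsk}_{\boldsymbol\xi}E^{ks}$ for all $r\in R$, $s\in S$, $k\in K^{rs}$; $\sum_{k\in K^{rs}}q^{rsk}_{\boldsymbol\xi}=d^{rs}_{\boldsymbol\xi}$ for all $r\in R$, $s\in S$. Market clearing: (C3) $g^k_{\boldsymbol\xi}-\sum_{r\in R}\sum_{s\in S}e^{rs}q^{rsk}_{\boldsymbol\xi}=0$ for all $k\in K$, $\boldsymbol\xi\in\boldsymbol\Xi$ (terms with $k\notin K^{rs}$ are omitted). System equilibrium: an investor strategy $(\boldsymbol c^*,\boldsymbol g^* )$, a traffic pattern $(\boldsymbol{\hat x}^*,\boldsymbol{\check x}^*,\boldsymbol x^*,\boldsymbol q^* )$ and prices $\boldsymbol\rho^*$ such that $(\boldsymbol c^*,\boldsymbol g^* )$ solves the investor problem for $\boldsymbol\rho^*$; for every $\boldsymbol\xi$, $(\boldsymbol{\hat x}^*_{\boldsymbol\xi},\boldsymbol{\check x}^*_{\boldsymbol\xi},\boldsymbol x^*_{\boldsymbol\xi},\boldsymbol q^*_{\boldsymbol\xi})$ solves the GCDA problem in scenario $\boldsymbol\xi$ for $\boldsymbol\rho^*_{\boldsymbol\xi}$; and $(\boldsymbol g^*,\boldsymbol q^* )$ satisfies (C3). Combined model: over nonnegative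 capacities $c^k$ and supplies $g^k_{\boldsymbol\xi}$ ($k\in K$, $\boldsymbol\xi\in\boldsymbol\Xi$), and nonnegative link flows $\boldsymbol{\hat x}^{rsk}_{\boldsymbol\xi},\boldsymbol{\check x}^{rsk}_{\boldsymbol\xi}\in\mathbb{R}^{\mathcal{A}}$, path flows $x_{p,\boldsymbol\xi}$ and trip flows $q^{rsk}_{\boldsymbol\xi}$ ($r\in R$, $s\in S$, $k\in K^{rs}$, $p\in P^{rsk}$, $\boldsymbol\xi\in\boldsymbol\Xi$), minimize $$F=\sum_{k\in K}\phi_c(c^k)+\mathbb{E}_{\boldsymbol\xi}\sum_{k\in K}\phi_g(g^k_{\boldsymbol\xi})+\mathbb{E}_{\boldsymbol\xi}\left\{\frac{\beta_1}{\beta_2}\sum_{a\in\mathcal{A}}\int_0^{v_{a,\boldsymbol\xi}}t_a(u)\,du+\frac1{\beta_2}\sum_{r\in R}\sum_{s\in S}\sum_{k\in K^{rs}}q^{rsk}_{\boldsymbol\xi}\left(\ln q^{rsk}_{\boldsymbol\xi}-1-\beta_0^k\right)\right\}$$ subject to (C1), (C2) for every $\boldsymbol\xi$, and (C3) with dual variables $\lambda^k_{\boldsymbol\xi}\in\mathbb{R}$. Primal-dual solution: a point satisfying (C1), (C2), (C3) and nonnegativity, together with $\boldsymbol\lambda$, such that the point minimizes the Lagrangian $F-\sum_{\boldsymbol\xi\in\boldsymbol\Xi}\sum_{k\in K}\lambda^k_{\boldsymbol\xi}\left(g^k_{\boldsymbol\xi}-\sum_{r\in R}\sum_{s\in S}e^{rs}q^{rsk}_{\boldsymbol\xi}\right)$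 over all nonnegative variables satisfying (C1) and (C2). *)

(* Defs.v *)
From HB Require Import structures.
From mathcomp Require Import all_boot all_order all_algebra finmap.
From mathcomp Require Import all_classical all_reals all_analysis.

Set Implicit Arguments.
Unset Strict Implicit.
Unset Printing Implicit Defensive.

Import Order.TTheory GRing.Theory Num.Theory.
Import numFieldNormedType.Exports.

Local Open Scope classical_set_scope.
Local Open Scope ring_scope.

(* No link is repeated in a sub-path, so that link-path incidence vectors are
   0/1. The empty list is a sub-path from a node to itself. *)
Fixpoint is_walk (N A : eqType) (src dst : A -> N) (i j : N) (p : seq A) : bool :=
  if p is a :: p' then (src a == i) && is_walk src dst (dst a) j p' else i == j.

Definition is_subpath (N A : eqType) (src dst : A -> N) (i j : N) (p : seq A) :=
  is_walk src dst i j p && uniq p.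

(* A path with service is the pair (sub-path up to the facility, sub-path from
   the facility on). *)
Record network := Network {
  node : finType;
  link : finType;
  src : link -> node;
  dst : link -> node;
  origins : {set node};
  destinations : {set node};
  facilities : {set node};
  avail : node -> node -> {set node};
  paths : node -> node -> node -> {fset seq link * seq link};
  avail_sub : forall r s, r \in origins -> s \in destinations ->
    avail r s \subset facilities;
  pathsP : forall r s k p, r \in origins -> s \in destinations ->
    k \in avail r s -> p \in paths r s k ->
    is_subpath src dst r k p.1 && is_subpath src dst k s p.2
}.

(* The functions [phi_c], [phi_g] and [travel_time a] have domain [0, +oo[; only
   their values there are relevant. *)
Record market (R : realType) (G : network) := Market {
  scenario : finType;
  prob : scenario -> R;
  demand : scenario -> node G -> node G -> R;
  service : node G -> node G -> R;
  beta0 : node G -> R;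
  beta1 : R;
  beta2 : R;
  phi_c : R -> R;
  phi_g : R -> R;
  travel_time : link G -> R -> R;
  prob_gt0 : forall xi, 0 < prob xi;
  prob_sum1 : \sum_xi prob xi = 1;
  beta1_gt0 : 0 < beta1;
  beta2_gt0 : 0 < beta2
}.

Section Optimisation.
Context {R : realType} {T : Type}.

Definition minimizes (D : set T) (f : T -> R) (x : T) : Prop :=
  D x /\ forall y, D y -> f x <= f y.

Definition maximizes (D : set T) (f : T -> R) (x : T) : Prop :=
  D x /\ forall y, D y -> f y <= f x.

End Optimisation.

Section Model.
Context {R : realType} {G : network} (M : market R G).

Definition incidence (n : node G) (a : link G) : R :=
  (src a == n)%:R - (dst a == n)%:R.

(* For [i = j] this is the zero vector. *)
Definition od_incidence (i j n : node G) : R := (i == n)%:R - (j == n)%:R.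

Definition link_path (p : seq (link G)) (a : link G) : R := (a \in p)%:R.

Definition expect (f : scenario M -> R) : R := \sum_xi prob xi * f xi.

(* Variables are total functions; only the coordinates with [k] a facility,
   resp. [r] an origin, [s] a destination, [k \in avail r s] and
   [p \in paths r s k], occur in the objectives and constraints. *)
Record investment := Investment {
  cap : node G -> R;
  supply : scenario M -> node G -> R
}.

Record traffic := Traffic {
  xhat : node G -> node G -> node G -> link G -> R;
  xcheck : node G -> node G -> node G -> link G -> R;
  xpath : node G -> node G -> node G -> seq (link G) * seq (link G) -> R;
  trips : node G -> node G -> node G -> R
}.

Definition prices := scenario M -> node G -> R.

Definition nonneg_investment (z : investment) : Prop :=
  forall k, k \in facilities G ->
    0 <= cap z k /\ forall xi, 0 <= supply z xi k.

Definition capacity_ok (z : investment) : Prop :=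
  forall k xi, k \in facilities G -> supply z xi k - cap z k <= 0.

Definition investment_feasible : set investment :=
  [set z | nonneg_investment z /\ capacity_ok z].

Definition investor_profit (rho : prices) (z : investment) : R :=
  expect (fun xi => \sum_(k in facilities G)
    (rho xi k * supply z xi k - phi_g M (supply z xi k)))
  - \sum_(k in facilities G) phi_c M (cap z k).

Definition solves_investor (rho : prices) (z : investment) : Prop :=
  maximizes investment_feasible (investor_profit rho) z.

Definition link_flow (y : traffic) (a : link G) : R :=
  \sum_(r in origins G) \sum_(s in destinations G) \sum_(k in avail r s)
    (xhat y r s k a + xcheck y r s k a).

Definition nonneg_traffic (y : traffic) : Prop :=
  forall r s k, r \in origins G -> s \in destinations G -> k \in avail r s ->
    [/\ forall a, 0 <= xhat y r s k a,
        forall a, 0 <= xcheck y r s k a,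
        forall p, p \in paths r s k -> 0 <= xpath y r s k p
      & 0 <= trips y r s k].

(* The aggregate link flow is not a variable: it is [link_flow y]. *)
Definition traffic_ok (xi : scenario M) (y : traffic) : Prop :=
  (forall r s k, r \in origins G -> s \in destinations G -> k \in avail r s ->
    [/\ forall a, xhat y r s k a + xcheck y r s k a =
          \sum_(p <- paths r s k)
            (link_path p.1 a + link_path p.2 a) * xpath y r s k p,
        forall n, \sum_a incidence n a * xhat y r s k a =
          trips y r s k * od_incidence r k n
      & forall n, \sum_a incidence n a * xcheck y r s k a =
          trips y r s k * od_incidence k s n]) /\
  (forall r s, r \in origins G -> s \in destinations G ->
    \sum_(k in avail r s) trips y r s k = demand xi r s).

Definition traffic_feasible (xi : scenario M) : set traffic :=
  [set y | nonneg_traffic y /\ traffic_ok xi y].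

Definition congestion (y : traffic) : R :=
  \sum_(a : link G)
    \int[lebesgue_measure]_(u in `[0, link_flow y a]) travel_time M a u.

(* [ln 0] is a real number, so [q * (ln q - 1 + w)] vanishes at [q = 0],
   in accordance with the convention 0 ln 0 = 0. *)
Definition gcda_objective (rho : node G -> R) (y : traffic) : R :=
  congestion y
  + (beta1 M)^-1 *
    \sum_(r in origins G) \sum_(s in destinations G) \sum_(k in avail r s)
      trips y r s k * (ln (trips y r s k) - 1
                       + beta2 M * rho k * service M r s - beta0 M k).

Definition solves_gcda (rho : node G -> R) (xi : scenario M) (y : traffic) :
    Prop :=
  minimizes (traffic_feasible xi) (gcda_objective rho) y.

Definition excess_supply (z : investment) (y : scenario M -> traffic)
    (xi : scenario M) (k : node G) : R :=
  supply z xi k -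
  \sum_(r in origins G) \sum_(s in destinations G | k \in avail r s)
    service M r s * trips (y xi) r s k.

Definition market_clears (z : investment) (y : scenario M -> traffic) : Prop :=
  forall k xi, k \in facilities G -> excess_supply z y xi k = 0.

Definition system_equilibrium (z : investment) (y : scenario M -> traffic)
    (rho : prices) : Prop :=
  [/\ solves_investor rho z,
      forall xi, solves_gcda (rho xi) xi (y xi)
    & market_clears z y].

Definition combined_objective (z : investment) (y : scenario M -> traffic) : R :=
  \sum_(k in facilities G) phi_c M (cap z k)
  + expect (fun xi => \sum_(k in facilities G) phi_g M (supply z xi k))
  + expect (fun xi =>
      beta1 M / beta2 M * congestion (y xi)
      + (beta2 M)^-1 *
        \sum_(r in origins G) \sum_(s in destinations G) \sum_(k in avail r s)
          trips (y xi) r s k * (ln (trips (y xi) r s k) - 1 - beta0 M k)).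

Definition lagrangian (lambda : prices)
    (w : investment * (scenario M -> traffic)) : R :=
  combined_objective w.1 w.2 -
  \sum_xi \sum_(k in facilities G) lambda xi k * excess_supply w.1 w.2 xi k.

(* Every constraint except market clearing, which is dualized. *)
Definition relaxed_feasible : set (investment * (scenario M -> traffic)) :=
  [set w | investment_feasible w.1 /\ forall xi, traffic_feasible xi (w.2 xi)].

Definition primal_dual_solution (z : investment) (y : scenario M -> traffic)
    (lambda : prices) : Prop :=
  market_clears z y /\
  minimizes relaxed_feasible (lagrangian lambda) (z, y).

End Model.

(* Main.v *)
Require Import Defs.
From HB Require Import structures.
From mathcomp Require Import all_boot all_order all_algebra finmap.
From mathcomp Require Import all_classical all_reals all_analysis.
From mathcomp Require Import ring.

Import Order.TTheory GRing.Theory Num.Theory.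
Import numFieldNormedType.Exports.

Local Open Scope classical_set_scope.
Local Open Scope ring_scope.

(** Market clearing is the only constraint that couples the investor with the
    travelers, and one scenario with another. Once it is dualized, the feasible
    set is a product, and with prices [rho = lambda / prob] the Lagrangian is a
    sum with one term for each factor ([lagrangian_separates]):

      - (profit of the investor) + sum over [xi] of
        [prob xi * (beta1 / beta2)] * (objective of the travelers in [xi]).

    The dual term [lambda * excess_supply] splits into the revenue
    [prob * rho * supply] of the investor and the payments
    [prob * rho * service * trips] of the travelers; the factor
    [beta1 / beta2] is the one that turns the price term
    [beta2 * rho * service / beta1] of the travelers into this payment.

    A point of a product minimizes such a sum, with positive weights, exactly
    when each of its components is optimal for its own term
    ([minimizes_separable]). So minimizing the Lagrangian means that the investor
    and the travelers of every scenario are at an optimum, and market clearing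
    is required on both sides of the equivalence. *)

(** If the point is optimal for the sum, then changing a single component leaves
    the other terms fixed, so that component cannot be improved; the weights have
    to be positive for this. The converse adds up the inequalities. *)
Lemma minimizes_separable (R : realType) (I : finType) (T U : Type)
    (D : set T) (E : I -> set U) (f : T -> R) (g : I -> U -> R) (c : I -> R)
    (z : T) (y : I -> U) :
  (forall i, 0 < c i) ->
  minimizes [set w : T * (I -> U) | D w.1 /\ forall i, E i (w.2 i)]
    (fun w => - f w.1 + \sum_i c i * g i (w.2 i)) (z, y) <->
  maximizes D f z /\ forall i, minimizes (E i) (g i) (y i).
Proof.
move=> c_gt0; split=> [[[/= Dz Ey] zy_min]|[[Dz z_max] y_min]].
  split=> [|i]; split=> //; [move=> z' Dz'|move=> u Eu].
    by have := zy_min (z', y) (conj Dz' Ey); rewrite /= lerD2r lerN2.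
  pose y' j := if j == i then u else y j.
  have Ey' j : E j (y' j) by rewrite /y'; case: eqP => [->|].
  have := zy_min (z, y') (conj Dz Ey').
  rewrite /= lerD2l (bigD1 i)//= [leRHS](bigD1 i)//= {1}/y' eqxx.
  rewrite [X in _ <= _ + X](eq_bigr (fun j => c j * g j (y j))) => [|j /negPf ji].
    by rewrite lerD2r ler_pM2l.
  by rewrite /y' ji.
split=> [|[z' y'] [/= Dz' Ey']]; first by split=> // i; case: (y_min i).
apply: lerD; first by rewrite lerN2; exact: z_max.
apply: ler_sum => i _; rewrite ler_pM2l//.
by case: (y_min i) => _; exact.
Qed.

Section Separation.
Context {R : realType} {G : network} (M : market R G).

(** What the travelers pay, counted by origin and destination on the left and
    by facility on the right. The two agree because travelers are served
    only at facilities. *)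
Lemma service_payments_by_facility (rho : node G -> R) (y : traffic (R := R) (G := G)) :
  \sum_(r in origins G) \sum_(s in destinations G) \sum_(k in avail r s)
    rho k * (service M r s * trips y r s k) =
  \sum_(k in facilities G) rho k *
    \sum_(r in origins G) \sum_(s in destinations G | k \in avail r s)
      service M r s * trips y r s k.
Proof.
under [RHS]eq_bigr => k _.
  rewrite mulr_sumr.
  under eq_bigr do rewrite mulr_sumr.
  over.
rewrite [RHS]exchange_big/=; apply: eq_bigr => r r_orig.
rewrite [RHS](exchange_big_dep (fun s => s \in destinations G))/=; last first.
  by move=> k s _ /andP[].
apply: eq_bigr => s s_dest; apply: eq_bigl => k.
rewrite s_dest /=; apply/idP/andP => [k_av|[]//]; split=> //.
exact: (fintype.subsetP (avail_sub r_orig s_dest)).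
Qed.

(** The weight [beta1 / beta2] converts the travelers' objective from units of
    travel time to units of money: the price term becomes exactly what they pay,
    and the rest is their share of the combined objective. *)
Lemma gcda_objectiveE (rho : node G -> R) (y : traffic (R := R) (G := G)) :
  beta1 M / beta2 M * gcda_objective M rho y =
  beta1 M / beta2 M * congestion M y
  + (beta2 M)^-1 *
    (\sum_(r in origins G) \sum_(s in destinations G) \sum_(k in avail r s)
      trips y r s k * (ln (trips y r s k) - 1 - beta0 M k))
  + \sum_(k in facilities G) rho k *
      \sum_(r in origins G) \sum_(s in destinations G | k \in avail r s)
        service M r s * trips y r s k.
Proof.
have b1 : beta1 M != 0 by rewrite gt_eqF// beta1_gt0.
have b2 : beta2 M != 0 by rewrite gt_eqF// beta2_gt0.
rewrite /gcda_objective mulrDr -addrA; congr (_ + _).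
rewrite -service_payments_by_facility mulrA.
rewrite (_ : _ / _ / _ = (beta2 M)^-1); last by field; rewrite b1 b2.
do 3 (rewrite !mulr_sumr -big_split/=; apply: eq_bigr => ? _).
by field.
Qed.

(** The price [lambda / prob] absorbs the probability that the expectation puts
    in front of revenues and payments, but not in front of the dual term. *)
Lemma lagrangian_separates (lambda : prices M)
    (w : investment M * (scenario M -> traffic (R := R) (G := G))) :
  lagrangian lambda w =
  - investor_profit (fun xi k => lambda xi k / prob xi) w.1
  + \sum_xi (prob xi * (beta1 M / beta2 M)) *
      gcda_objective M (fun k => lambda xi k / prob xi) (w.2 xi).
Proof.
rewrite /lagrangian /combined_objective /investor_profit /expect.
rewrite opprB -!addrA; congr (_ + _).
rewrite -!sumrN -!big_split/=; apply: eq_bigr => xi _.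
rewrite -(mulrA (prob xi)) gcda_objectiveE /excess_supply.
have p0 : prob xi != 0 by rewrite gt_eqF// prob_gt0.
rewrite sumrB.
under [X in _ + (_ - X) = _]eq_bigr do rewrite mulrBr.
rewrite sumrB.
have factor_prob (u : node G -> R) :
    \sum_(k in facilities G) lambda xi k * u k =
    prob xi * \sum_(k in facilities G) lambda xi k / prob xi * u k.
  by rewrite mulr_sumr; apply: eq_bigr => k _; field.
rewrite !factor_prob.
ring.
Qed.

End Separation.

Theorem lemma3 (R : realType) (G : network) (M : market R G)
  (phi_c_convex : convex_function (`[0, +oo[%classic : set R^o) (phi_c M))
  (phi_g_convex : convex_function (`[0, +oo[%classic : set R^o) (phi_g M))
  (travel_time_incr : forall a : link G,
     {in `[0, +oo[ &, {homo travel_time M a : u v / u <= v}})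
  (z : investment M) (y : scenario M -> traffic (R := R) (G := G))
  (lambda : scenario M -> node G -> R) :
  primal_dual_solution z y lambda <->
  system_equilibrium z y (fun xi k => lambda xi k / prob xi).
Proof.
have weight_gt0 (xi : scenario M) : 0 < prob xi * (beta1 M / beta2 M).
  by rewrite mulr_gt0 ?prob_gt0// divr_gt0 ?beta1_gt0 ?beta2_gt0.
rewrite /primal_dual_solution (funext (lagrangian_separates M lambda)).
have /= sep := minimizes_separable _ _ _ _ (investment_feasible (M := M))
  (traffic_feasible (M := M))
  (investor_profit (fun xi k => lambda xi k / prob xi))
  (fun xi => gcda_objective M (fun k => lambda xi k / prob xi)) _ z y weight_gt0.
split=> [[clears /sep[]] //|[z_opt y_opt clears]].
by split=> //; apply/sep.
Qed.
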